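(* The following hold for varieties of inverse semigroups. (i) The varieties $\langle B_2^1\rangle$ and $\langle M_n\rangle$, for any positive integer $n$, are locally $\mathcal{H}$-finite. As a consequence, so are the varieties $\mathbf{G}\vee\langle M_n\rangle$, for any positive integer $n$, and all the subvarieties of $\mathbf{G}\vee\langle B_2^1\rangle$. (ii) The varieties $\mathbf{C_2}$ and $\langle B\rangle$, as well as all the varieties of inverse semigroups that contain either $\mathbf{C_2}$ or $\langle B\rangle$, are not locally $\mathcal{K}$-finite, for any $\mathcal{K}\in\{\mathcal{H},\mathcal{L},\mathcal{R},\mathcal{D},\mathcal{J}\}$.
   Context: Green's relations on a semigroup $S$: $a\,\mathcal{L}\,b \iff S^1a=S^1b$; $a\,\mathcal{R}\,b\iff aS^1=bS^1$; $a\,\mathcal{J}\,b\iff S^1aS^1=S^1bS^1$; $\mathcal{H}=\mathcal{L}\cap\mathcal{R}$; $\mathcal{D}=\mathcal{L}\vee\mathcal{R}$. For $\mathcal{K}\in\{\mathcal{H},\mathcal{L},\mathcal{R},\mathcal{D},\mathcal{J}\}$, a semigroup is $\mathcal{K}$-finite if it has only finitely many distinct $\mathcal{K}$-classes. A variety $\mathbf{V}$ is locally $\mathcal{K}$-finite if each finitely generated member of $\mathbf{V}$ is $\mathcal{K}$-finite. Inverse semigroups are viewed as algebras of type $(2,1)$, with unary operation $a\mapsto a^{-1}$; varieties, generation and ''finitely generated'' refer to this type. $\langle S\rangle$ denotes the variety (of inverse semigroups) generated by $S$, and $\vee$ denotes join in the lattice of varieties of inverse semigroups. $\mathbf{G}$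 is the variety of all groups. $\mathbf{C_2}$ is the variety of all inverse semigroups satisfying the identity $x^2=x^3$. $B_2$ is the five-element Brandt semigroup, i.e. the inverse semigroup presented by a generator $a$ and relation $a^2=0$, and $B_2^1$ is $B_2$ with an identity adjoined. $FIS_a$ is the free monogenic inverse semigroup on generator $a$, and $M_n$ is the Rees quotient $FIS_a/I_n$, where $I_n$ is the ideal of $FIS_a$ generated by $a^n$. $B=\mathbb{N}_0\times\mathbb{N}_0$ is the bicyclic monoid, with operation $(m,n)(p,q)=(m-n+\max\{n,p\},\,q-p+\max\{n,p\})$. *)

(* Defs.v *)
From Stdlib Require Export Relations.
From mathcomp Require Export all_boot boolp classical_sets cardinality.
From mathcomp Require Import zify.

Set Implicit Arguments.
Unset Strict Implicit.
Unset Printing Implicit Defensive.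

Local Open Scope classical_set_scope.

(* The carrier is a bare type and not a mathcomp semigroupType: classes of
   inverse semigroups are quantified over, and must be closed under products
   of arbitrary families, without fixing a choice structure. *)
Record invSemigroup := InvSemigroup {
  carrier :> Type;
  mul : carrier -> carrier -> carrier;
  inv : carrier -> carrier;
  carrier_nonempty : exists x : carrier, True;
  mulA : forall x y z, mul x (mul y z) = mul (mul x y) z;
  (* inv x is the unique y such that x y x = x and y x y = y *)
  invP : forall x y, mul (mul x y) x = x /\ mul (mul y x) y = y <-> y = inv x
}.

Section Green.
Variable S : invSemigroup.
Implicit Types a b x : S.

(* S^1 a, a S^1 and S^1 a S^1 *)
Definition lideal a : set S := [set x | x = a \/ exists s, x = mul s a].
Definition rideal a : set S := [set x | x = a \/ exists s, x = mul a s].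
Definition jideal a : set S :=
  [set x | [\/ x = a, exists s, x = mul s a, exists t, x = mul a t
             | exists s t, x = mul (mul s a) t]].

Definition greenL a b := lideal a = lideal b.
Definition greenR a b := rideal a = rideal b.
Definition greenJ a b := jideal a = jideal b.
Definition greenH a b := greenL a b /\ greenR a b.
(* The join is taken in the lattice of equivalence relations on S. *)
Definition greenD : S -> S -> Prop :=
  clos_refl_sym_trans S (fun a b => greenL a b \/ greenR a b).

End Green.

Inductive green := GreenH | GreenL | GreenR | GreenD | GreenJ.

Definition green_rel (K : green) (S : invSemigroup) : S -> S -> Prop :=
  match K with
  | GreenH => @greenH S
  | GreenL => @greenL S
  | GreenR => @greenR S
  | GreenD => @greenD S
  | GreenJ => @greenJ S
  end.

Definition green_classes (K : green) (S : invSemigroup) : set (set S) :=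
  [set C | exists a, C = [set b | green_rel K a b]].

Definition green_finite (K : green) (S : invSemigroup) : Prop :=
  finite_set (@green_classes K S).

Definition hom (S T : invSemigroup) (f : S -> T) : Prop :=
  (forall x y, f (mul x y) = mul (f x) (f y)) /\
  (forall x, f (inv x) = inv (f x)).

Definition subalgebra (S : invSemigroup) (U : set S) : Prop :=
  (forall x y, U x -> U y -> U (mul x y)) /\ (forall x, U x -> U (inv x)).

Definition finitely_generated (S : invSemigroup) : Prop :=
  exists X : set S, finite_set X /\ smallest (@subalgebra S) X = setT.

(* Classes are plain predicates: the type of inverse semigroups is large, and
   should not be made to live in the universe over which [set] ranges. *)
Definition isclass := invSemigroup -> Prop.

Definition subclass (V W : isclass) : Prop := forall S, V S -> W S.

(* [P], with the maps [p i], is a direct product of the family [A]. *)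
Definition is_product (I : Type) (A : I -> invSemigroup) (P : invSemigroup)
    (p : forall i, P -> A i) : Prop :=
  (forall i, hom (p i)) /\
  (forall x : forall i, A i, exists! y : P, forall i, p i y = x i).

(* Closure under homomorphic images, subalgebras and direct products, each up
   to isomorphism. *)
Definition variety (V : isclass) : Prop :=
  [/\ forall (S T : invSemigroup) (f : S -> T),
        hom f -> (forall y, exists x, f x = y) -> V S -> V T,
      forall (S T : invSemigroup) (f : T -> S),
        hom f -> injective f -> V S -> V T
    & forall (I : Type) (A : I -> invSemigroup) (P : invSemigroup)
        (p : forall i, P -> A i),
        is_product p -> (forall i, V (A i)) -> V P].

Definition variety_span (C : isclass) : isclass :=
  fun S => forall V, variety V -> subclass C V -> V S.

Definition generated_by (S : invSemigroup) : isclass :=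
  variety_span (fun T => T = S).

Definition vjoin (V W : isclass) : isclass :=
  variety_span (fun S => V S \/ W S).

Definition locally_finite (K : green) (V : isclass) : Prop :=
  forall S, V S -> finitely_generated S -> green_finite K S.

Lemma variety_spanP C : variety (variety_span C).
Proof.
split.
- by move=> S T f hf sf VS V vV CV; have [h _ _] := vV; apply: h hf sf (VS _ vV CV).
- by move=> S T f hf jf VS V vV CV; have [_ h _] := vV; apply: h hf jf (VS _ vV CV).
- move=> I A P p hp VA V vV CV; have [_ _ h] := vV.
  by apply: h hp _ => i; apply: VA.
Qed.

Definition groups : isclass := fun S =>
  exists e : S, forall x, [/\ mul e x = x, mul x e = x,
                              mul x (inv x) = e & mul (inv x) x = e].

Definition C2 : isclass := fun S => forall x : S, mul x x = mul (mul x x) x.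

Lemma groups_variety : variety groups.
Proof.
split.
- move=> S T f [fM fV] sf [e He]; exists (f e) => y.
  by have [x <-] := sf y; have [h1 h2 h3 h4] := He x; rewrite -fV -!fM h1 h2 h3 h4.
- move=> S T f [fM fV] jf [e He]; have [t _] := carrier_nonempty T.
  have fe x : f (mul x (inv x)) = e by rewrite fM fV; have [_ _ ->] := He (f x).
  exists (mul t (inv t)) => x; have [h1 h2 h3 h4] := He (f x).
  by split; apply: jf; rewrite ?fe ?fe ?(fM (mul _ _)) ?(fM _ (mul _ _)) ?fe ?fM ?fV.
- move=> I A P p [hp bp] GA.
  pose e i := sval (cid (GA i)).
  have eP i x := svalP (cid (GA i)) x.
  have [q [Hq _]] := bp e.
  have inj x y : (forall i, p i x = p i y) -> x = y.
    move=> h; have [z [_ Hz]] := bp (fun i => p i y).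
    by rewrite -(Hz x h) -(Hz y (fun=> erefl)).
  exists q => x; split; apply: inj => i; have [pM pV] := hp i;
    by have [h1 h2 h3 h4] := eP i (p i x); rewrite pM ?pV Hq.
Qed.

Lemma C2_variety : variety C2.
Proof.
split.
- by move=> S T f [fM _] sf CS y; have [x <-] := sf y; rewrite -!fM -CS.
- by move=> S T f [fM _] jf CS x; apply: jf; rewrite !fM -CS.
- move=> I A P p [hp bp] CA x.
  have [z [_ Hz]] := bp (fun i => p i (mul x x)).
  transitivity z; [symmetry|]; apply: Hz => i //.
  by have [pM _] := hp i; rewrite !pM; symmetry; apply: CA.
Qed.

Definition bicyclic_mul (x y : nat * nat) : nat * nat :=
  (x.1 + (maxn x.2 y.1 - x.2), y.2 + (maxn x.2 y.1 - y.1)).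

Definition bicyclic_inv (x : nat * nat) : nat * nat := (x.2, x.1).

Lemma bicyclic_mulA x y z :
  bicyclic_mul x (bicyclic_mul y z) = bicyclic_mul (bicyclic_mul x y) z.
Proof.
case: x y z => [a b] [c d] [e f]; rewrite /bicyclic_mul /=.
by apply/pair_equal_spec; lia.
Qed.

Lemma bicyclic_invP x y :
  bicyclic_mul (bicyclic_mul x y) x = x /\
  bicyclic_mul (bicyclic_mul y x) y = y <-> y = bicyclic_inv x.
Proof.
case: x y => [a b] [c d]; rewrite /bicyclic_mul /bicyclic_inv /=.
rewrite !pair_equal_spec; lia.
Qed.

Definition bicyclic : invSemigroup :=
  InvSemigroup (ex_intro _ (0, 0) I) bicyclic_mulA bicyclic_invP.

(* [Some (i, j)] is the matrix unit e_ij and [None] is the zero; a generator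
   a with a^2 = 0 is [Some (false, true)]. *)
Definition B2_mul (x y : option (bool * bool)) : option (bool * bool) :=
  match x, y with
  | Some (i, j), Some (k, l) => if j == k then Some (i, l) else None
  | _, _ => None
  end.

Definition B2_inv (x : option (bool * bool)) : option (bool * bool) :=
  omap (fun ij => (ij.2, ij.1)) x.

Lemma B2_mulA x y z : B2_mul x (B2_mul y z) = B2_mul (B2_mul x y) z.
Proof. by move: x y z => [[[] []]|] [[[] []]|] [[[] []]|]. Qed.

Lemma B2_invP x y :
  B2_mul (B2_mul x y) x = x /\ B2_mul (B2_mul y x) y = y <-> y = B2_inv x.
Proof. by move: x y => [[[] []]|] [[[] []]|]; split => // -[]. Qed.

Definition B2 : invSemigroup :=
  InvSemigroup (ex_intro _ None I) B2_mulA B2_invP.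

Section Adjoin.
Variable S : invSemigroup.

Definition adj1_mul (x y : option S) : option S :=
  match x, y with
  | Some a, Some b => Some (mul a b)
  | None, _ => y
  | _, None => x
  end.

Definition adj1_inv (x : option S) : option S := omap (@inv S) x.

Lemma adj1_mulA x y z : adj1_mul x (adj1_mul y z) = adj1_mul (adj1_mul x y) z.
Proof. by move: x y z => [x|] [y|] [z|] //=; rewrite mulA. Qed.

Lemma adj1_invP x y :
  adj1_mul (adj1_mul x y) x = x /\ adj1_mul (adj1_mul y x) y = y <->
  y = adj1_inv x.
Proof.
have key (a b : S) : b = inv a -> mul (mul a b) a = a /\ mul (mul b a) b = b.
  by move/(invP a b).
case: x y => [x|] [y|] /=; split=> //.
- by case=> -[h1] [h2]; congr Some; apply/(invP x y).
- by case=> /key[-> ->].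
- by case.
- by case.
Qed.

Definition adjoin1 : invSemigroup :=
  InvSemigroup (ex_intro _ None I) adj1_mulA adj1_invP.

End Adjoin.

Section Quotient.
Variables (T : Type) (R : T -> T -> Prop).
Hypothesis R_equiv : equivalence T R.

Definition quot := {C : T -> Prop | exists x, C = R x}.

Definition cls (x : T) : quot := exist _ (R x) (ex_intro _ x erefl).

Definition rep (X : quot) : T := sval (cid (svalP X)).

Lemma clsP x y : cls x = cls y <-> R x y.
Proof.
have [Rr Rt Rs] := R_equiv; split=> [[->]|Rxy]; first exact: Rr.
apply: eq_exist; apply/funext => z; apply/propext; split; apply: Rt => //.
exact: Rs.
Qed.

Lemma repK X : cls (rep X) = X.
Proof.
rewrite /rep; case: cid => x /= e; case: X e => C hC /= e.
by apply: eq_exist.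
Qed.

Lemma cls_rep x : R x (rep (cls x)).
Proof. by apply/clsP; rewrite repK. Qed.

End Quotient.

Inductive term := Gen | Mul of term & term | Inv of term.

Fixpoint eval (S : invSemigroup) (a : S) (t : term) : S :=
  match t with
  | Gen => a
  | Mul t1 t2 => mul (eval a t1) (eval a t2)
  | Inv t1 => inv (eval a t1)
  end.

(* Terms are identified when they take the same values in all inverse
   semigroups; the quotient is free on [Gen] by [FIS_universal] below. *)
Definition term_eq (s t : term) : Prop :=
  forall (S : invSemigroup) (a : S), eval a s = eval a t.

Lemma term_eq_equiv : equivalence term term_eq.
Proof.
split=> [s S a|s t u st tu S a|s t st S a] //.
by rewrite st tu.
Qed.

Definition FIS_mul (X Y : quot term_eq) : quot term_eq :=
  cls term_eq (Mul (rep X) (rep Y)).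

Definition FIS_inv (X : quot term_eq) : quot term_eq :=
  cls term_eq (Inv (rep X)).

Lemma FIS_mulE s t :
  FIS_mul (cls term_eq s) (cls term_eq t) = cls term_eq (Mul s t).
Proof.
apply/(clsP term_eq_equiv) => S a /=.
by rewrite -(cls_rep term_eq_equiv s) -(cls_rep term_eq_equiv t).
Qed.

Lemma FIS_invE s : FIS_inv (cls term_eq s) = cls term_eq (Inv s).
Proof.
apply/(clsP term_eq_equiv) => S a /=.
by rewrite -(cls_rep term_eq_equiv s).
Qed.

Lemma FIS_mulA X Y Z : FIS_mul X (FIS_mul Y Z) = FIS_mul (FIS_mul X Y) Z.
Proof.
rewrite -(repK X) -(repK Y) -(repK Z) !FIS_mulE.
by apply/(clsP term_eq_equiv) => S a; apply: mulA.
Qed.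

Lemma FIS_invP X Y :
  FIS_mul (FIS_mul X Y) X = X /\ FIS_mul (FIS_mul Y X) Y = Y <->
  Y = FIS_inv X.
Proof.
rewrite -(repK X) -(repK Y) !FIS_mulE FIS_invE !(clsP term_eq_equiv).
split=> [[h1 h2] S a|h].
  by apply/invP; split; [apply: h1 | apply: h2].
by split=> S a; case/invP: (h S a).
Qed.

Definition FIS : invSemigroup :=
  InvSemigroup (ex_intro _ (cls term_eq Gen) I) FIS_mulA FIS_invP.

Definition FIS_gen : FIS := cls term_eq Gen.

Lemma FIS_universal (S : invSemigroup) (a : S) :
  exists! f : FIS -> S, hom f /\ f FIS_gen = a.
Proof.
have evE t : eval a (rep (cls term_eq t)) = eval a t.
  by rewrite -(cls_rep term_eq_equiv t).
exists (fun X => eval a (rep X)); split.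
  by split; [split=> [x y|x] |]; exact: evE.
move=> g [[gM gV] gg]; apply/funext => X; rewrite -{2}(repK X).
elim: (rep X) => [|s IHs t IHt|s IHs] /=; first by rewrite -gg.
  by rewrite IHs IHt -gM; congr g; apply: FIS_mulE.
by rewrite IHs -gV; congr g; apply: FIS_invE.
Qed.

Definition ideal (S : invSemigroup) (J : set S) : Prop :=
  forall s x, J x -> J (mul s x) /\ J (mul x s).

Section Rees.
Variables (S : invSemigroup) (J : set S).
Hypothesis J_ideal : ideal J.

Definition rees_eq (x y : S) : Prop := x = y \/ J x /\ J y.

Lemma rees_eq_equiv : equivalence S rees_eq.
Proof.
split=> [x|x y z|x y]; first by left.
- by case=> [->//|[Jx Jy]] [<-|[_ Jz]]; right.
- by case=> [->|[Jx Jy]]; [left | right].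
Qed.

Definition rees_mul (X Y : quot rees_eq) : quot rees_eq :=
  cls rees_eq (mul (rep X) (rep Y)).

Definition rees_inv (X : quot rees_eq) : quot rees_eq :=
  cls rees_eq (inv (rep X)).

Lemma inv_spec (x : S) :
  mul (mul x (inv x)) x = x /\ mul (mul (inv x) x) (inv x) = inv x.
Proof. exact/invP. Qed.

Lemma ideal_inv x : J x -> J (inv x).
Proof.
move=> Jx; have [_ <-] := inv_spec x.
by apply: (J_ideal _ _).2; apply: (J_ideal _ _).1.
Qed.

Lemma rees_mulE x y :
  rees_mul (cls rees_eq x) (cls rees_eq y) = cls rees_eq (mul x y).
Proof.
apply/(clsP rees_eq_equiv).
have [<-|[Jx Jx']] := cls_rep rees_eq_equiv x;
  have [<-|[Jy Jy']] := cls_rep rees_eq_equiv y; first by left.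
- by right; split; apply: (J_ideal _ _).1.
- by right; split; apply: (J_ideal _ _).2.
- by right; split; apply: (J_ideal _ _).1.
Qed.

Lemma rees_invE x : rees_inv (cls rees_eq x) = cls rees_eq (inv x).
Proof.
apply/(clsP rees_eq_equiv).
have [<-|[Jx Jx']] := cls_rep rees_eq_equiv x; first by left.
by right; split; apply: ideal_inv.
Qed.

Lemma rees_mulA X Y Z : rees_mul X (rees_mul Y Z) = rees_mul (rees_mul X Y) Z.
Proof. by rewrite -(repK X) -(repK Y) -(repK Z) !rees_mulE mulA. Qed.

Lemma rees_invP X Y :
  rees_mul (rees_mul X Y) X = X /\ rees_mul (rees_mul Y X) Y = Y <->
  Y = rees_inv X.
Proof.
rewrite -(repK X) -(repK Y); move: (rep X) (rep Y) => x y {X Y}.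
have JM u v : J u -> J (mul (mul v u) v).
  by move=> Ju; apply: (J_ideal _ _).2; apply: (J_ideal _ _).1.
split; last first.
  move=> ->; rewrite rees_invE !rees_mulE.
  by have [-> ->] := inv_spec x.
rewrite !rees_mulE rees_invE !(clsP rees_eq_equiv) => -[].
have inJ : J x -> (mul (mul y x) y = y \/ J (mul (mul y x) y) /\ J y) ->
    rees_eq y (inv x).
  move=> Jx h; right; split; last exact: ideal_inv.
  by case: h => [<-|[]//]; apply: JM.
case=> [h1|[_ Jx]]; last exact: inJ.
case=> [h2|[_ Jy]]; first by left; apply/invP.
have Jx : J x by rewrite -h1; apply: JM.
by apply: inJ => //; right; split=> //; apply: JM.
Qed.

Definition rees : invSemigroup :=
  InvSemigroup
    (let: ex_intro x _ := carrier_nonempty S in ex_intro _ (cls rees_eq x) I)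
    rees_mulA rees_invP.

End Rees.

Lemma smallest_ideal (S : invSemigroup) (X : set S) :
  ideal (smallest (@ideal S) X).
Proof.
move=> s x Jx; split=> J [iJ XJ]; have Jx' : J x by exact: Jx.
  exact: (iJ _ _ Jx').1.
exact: (iJ _ _ Jx').2.
Qed.

(* [iterop n mul a a] is a^n for n > 0. *)
Definition M (n : nat) : invSemigroup :=
  rees (@smallest_ideal FIS
          [set iterop n (@mul FIS) FIS_gen FIS_gen]).

(* Main.v *)
From mathcomp Require Import all_boot zify.
Require Import Defs.

(** Positive part. In an inverse semigroup, a and b are H-related as soon as
    a a^-1 = b b^-1 and a^-1 a = b^-1 b, so H-equivalence of the values of two
    terms can be guaranteed by two identities. All groups satisfy every identity
    t t^-1 = u u^-1 and t^-1 t = u^-1 u, and a finite S satisfies those for which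
    t t^-1, u u^-1 (and t^-1 t, u^-1 u) induce the same function on S. For terms in
    k variables there are finitely many such functions, and identities pass from
    the groups and S to the variety that they generate; hence a k-generated
    member of the join of the variety of groups with <S> has finitely many
    H-classes ([locally_H_finite_join_groups]). This applies to B_2^1, and to
    M_n once it is known to be finite: every element of a monogenic inverse
    semigroup is some a^-p a^(q+1) a^-r with p, r <= q+1 ([nforms_eval]), and it
    lies in I_n when q+1 >= n.

    Negative part. Every Green relation is contained in J, so it is enough to
    exhibit, in the variety at hand, elements u_0, u_1, ... of a finitely generated
    subalgebra such that u_n is in the ideal generated by u_m only for
    m <= n ([not_locally_finite]).

    For <B>, the element a = ((1,0),(0,1)) of B x B generates a semigroup of
    elements ((i,j),(k,l)) with i+k = j+l. On such elements this common value
    does not decrease under multiplication on either side, and it is n+1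
    on u_n = a^(n+1).

    For C_2, fix a square-free word w over a finite alphabet, and let each letter
    act by partial injections on the disjoint union of the paths 0 -> 1 -> ... -> N
    whose edges are labelled by w. An element of the semigroup so generated moves
    all the vertices of its domain along one and the same label. If it moves x to y
    and y to z, then the label is read twice in a row; w being square-free,
    the label is empty. So every square is idempotent and x^2 = x^3 holds. The
    prefix u_n of length n+1 can be read on the path of length n+1, and nothing
    longer can. A square-free word on four letters is obtained by recording for
    each i its parity together with the paper-folding sequence, the residue mod 4
    of its odd part ([fold_word_squarefree]). *)

Set Implicit Arguments.
Unset Strict Implicit.
Unset Printing Implicit Defensive.

Local Open Scope classical_set_scope.

(** * Inverse semigroups *)

Section InverseSemigroup.
Variable S : invSemigroup.
Implicit Types x y a b : S.

Lemma mulVK x : mul (mul x (inv x)) x = x.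
Proof. exact: (inv_spec x).1. Qed.

Lemma mulKV x : mul (mul (inv x) x) (inv x) = inv x.
Proof. exact: (inv_spec x).2. Qed.

Lemma inv_unique x y :
  mul (mul x y) x = x -> mul (mul y x) y = y -> y = inv x.
Proof. by move=> h1 h2; apply/invP. Qed.

Lemma invK x : inv (inv x) = x.
Proof. by symmetry; apply: inv_unique; rewrite ?mulVK ?mulKV. Qed.

Lemma inv_idem a : mul a a = a -> inv a = a.
Proof. by move=> aa; symmetry; apply: inv_unique; rewrite !aa. Qed.

Lemma mulxV_idem x : mul (mul x (inv x)) (mul x (inv x)) = mul x (inv x).
Proof. by rewrite mulA mulVK. Qed.

Lemma mulVx_idem x : mul (mul (inv x) x) (mul (inv x) x) = mul (inv x) x.
Proof. by rewrite mulA mulKV. Qed.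

(** For idempotents a and b, the element b (a b)^-1 a is another inverse of
    a b, hence (a b)^-1, and it is visibly idempotent; so a b is idempotent. *)
Lemma idem_mul a b : mul a a = a -> mul b b = b ->
  mul (mul a b) (mul a b) = mul a b.
Proof.
move=> aa bb; set c := inv (mul a b).
have c1 : mul (mul (mul a b) c) (mul a b) = mul a b by exact: mulVK.
have c2 : mul (mul c (mul a b)) c = c by exact: mulKV.
have e : mul (mul b c) a = c.
  apply: inv_unique.
    rewrite -[RHS]c1 !mulA -(mulA a b b) bb -(mulA _ a a) aa.
    by rewrite ?mulA.
  rewrite !mulA -(mulA _ a a) aa -(mulA _ b b) bb.
  have := congr1 (fun z => mul (mul b z) a) c2.
  by rewrite !mulA.
have cc : mul c c = c.
  rewrite -{1 2}e !mulA.
  have := congr1 (fun z => mul (mul b z) a) c2.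
  by rewrite !mulA e.
have -> : mul a b = c by rewrite -(inv_idem cc) invK.
exact: cc.
Qed.

Lemma idem_comm a b : mul a a = a -> mul b b = b -> mul a b = mul b a.
Proof.
move=> aa bb.
have hab := idem_mul aa bb; have hba := idem_mul bb aa.
rewrite -[LHS](inv_idem hab); symmetry; apply: inv_unique.
  by rewrite !mulA -(mulA a b b) bb -(mulA _ a a) aa -{2}hab !mulA.
by rewrite !mulA -(mulA b a a) aa -(mulA _ b b) bb -{2}hba !mulA.
Qed.

Lemma invM a b : inv (mul a b) = mul (inv b) (inv a).
Proof.
have cm : mul (mul (inv a) a) (mul b (inv b)) =
          mul (mul b (inv b)) (mul (inv a) a).
  by apply: idem_comm; [exact: mulVx_idem | exact: mulxV_idem].
symmetry; apply: inv_unique.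
  transitivity (mul a (mul (mul (mul b (inv b)) (mul (inv a) a)) b)).
    by rewrite !mulA.
  by rewrite -cm !mulA mulVK -2!mulA [mul b _]mulA mulVK.
transitivity (mul (inv b) (mul (mul (mul (inv a) a) (mul b (inv b))) (inv a))).
  by rewrite !mulA.
by rewrite cm !mulA mulKV -2!mulA [mul (inv a) _]mulA mulKV.
Qed.

(** When a^-1 a = b^-1 b, each of a and b is a left multiple of the other:
    a = a a^-1 a = (a b^-1) b. Dually on the other side. *)
Lemma greenH_idem a b :
  mul a (inv a) = mul b (inv b) -> mul (inv a) a = mul (inv b) b ->
  greenH a b.
Proof.
have sub (c d : S) : mul (inv c) c = mul (inv d) d -> lideal c `<=` lideal d.
  move=> cd x; have cE : c = mul (mul c (inv d)) d.
    by rewrite -mulA -cd mulA mulVK.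
  case=> [->|[s ->]]; right; first by exists (mul c (inv d)).
  by exists (mul s (mul c (inv d))); rewrite {1}cE !mulA.
have sub' (c d : S) : mul c (inv c) = mul d (inv d) -> rideal c `<=` rideal d.
  move=> cd x; have cE : c = mul d (mul (inv d) c).
    by rewrite mulA -cd mulVK.
  case=> [->|[s ->]]; right; first by exists (mul (inv d) c).
  by exists (mul (mul (inv d) c) s); rewrite {1}cE !mulA.
by move=> h1 h2; split; apply/seteqP; split;
  [exact: sub|exact: sub|exact: sub'|exact: sub'].
Qed.

End InverseSemigroup.

(** * Identities and local H-finiteness *)

Inductive iterm (I : Type) :=
  | TVar of I | TMul of iterm I & iterm I | TInv of iterm I.

Fixpoint teval (I : Type) (S : invSemigroup) (r : I -> S) (t : iterm I) : S :=
  match t with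
  | TVar i => r i
  | TMul t1 t2 => mul (teval r t1) (teval r t2)
  | TInv t1 => inv (teval r t1)
  end.

Lemma hom_teval I (S T : invSemigroup) (f : S -> T) (r : I -> S) t :
  hom f -> f (teval r t) = teval (fun i => f (r i)) t.
Proof.
by case=> fM fV; elim: t => [i|t1 IH1 t2 IH2|t1 IH] //=;
  rewrite ?fM ?fV ?IH1 ?IH2 ?IH.
Qed.

Lemma product_inj I (A : I -> invSemigroup) (P : invSemigroup)
    (p : forall i, P -> A i) (x y : P) :
  is_product p -> (forall i, p i x = p i y) -> x = y.
Proof.
move=> [_ bp] h; have [z [_ Hz]] := bp (fun i => p i y).
by rewrite -(Hz x h) -(Hz y (fun=> erefl)).
Qed.

Definition satisfies I (u v : iterm I) : isclass :=
  fun S => forall r : I -> S, teval r u = teval r v.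

Lemma variety_satisfies I (u v : iterm I) : variety (satisfies u v).
Proof.
split.
- move=> S T f hf sf Suv r.
  have [q rq] := boolp.choice (fun i => sf (r i)).
  have -> : r = fun i => f (q i) by apply/funext.
  by rewrite -!hom_teval // Suv.
- by move=> S T f hf jf Suv r; apply: jf; rewrite !hom_teval // Suv.
- move=> J A P p hp Auv r; apply: (product_inj hp) => j.
  by have [hom_p _] := hp; rewrite !hom_teval // Auv.
Qed.

Lemma smallest_subalgebra (S : invSemigroup) (X : set S) :
  subalgebra (smallest (@subalgebra S) X).
Proof.
split=> [x y Ux Uy|x Ux] U hU; have [UM UV] := hU.1.
  by apply: UM; [exact: Ux | exact: Uy].
by apply: UV; exact: Ux.
Qed.

Lemma smallest_teval (S : invSemigroup) (X : set S) I (r : I -> S) :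
  X `<=` range r -> smallest (@subalgebra S) X `<=` range (teval r).
Proof.
move=> Xr; apply: smallest_sub; last first.
  by move=> x /Xr[i _ <-]; exists (TVar i).
split=> [x y [t _ <-] [u _ <-]|x [t _ <-]]; first by exists (TMul t u).
by exists (TInv t).
Qed.

(** P will be the type of all terms, and the profile of a term a finite amount
    of data that determines the Green class of its value. *)
Lemma green_classes_finite (K : green) (S : invSemigroup) (F : finType) (P : Type)
    (e : P -> S) (prof : P -> F) :
  range e = setT ->
  (forall t u, prof t = prof u ->
     [set b | green_rel K (e t) b] = [set b | green_rel K (e u) b]) ->
  green_finite K S.
Proof.
move=> se pe.
pose C (c : F) : set S :=
  if pselect (exists t, prof t = c) is left h
  then [set b | green_rel K (e (sval (cid h))) b] else set0.
apply: (@sub_finite_set _ _ (C @` setT)); last exact/finite_image/finite_finset.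
move=> _ [a ->]; have [t _ <-] : range e a by rewrite se.
exists (prof t) => //; rewrite /C; case: pselect => [h|[]]; last by exists t.
by apply: pe; apply: (svalP (cid h)).
Qed.

(** The profile of a term t records the functions that t t^-1 and t^-1 t induce
    on S, read through a section g of the enumeration h. Two terms with the same
    profile satisfy in S, and trivially in groups, the identities that make
    their values H-related. *)
Lemma locally_H_finite_join_groups (F : finType) (S : invSemigroup) (h : F -> S) :
  (forall x, exists y, h y = x) ->
  locally_finite GreenH (vjoin groups (generated_by S)).
Proof.
move=> sh T VT [X [fX gX]].
have [g hg] := boolp.choice sh.
have [s Xs] := (@finite_seqP {classic T} X).1 fX.
pose r (i : 'I_(size s)) : T := tnth (in_tuple s) i.
pose prof (t : iterm 'I_(size s)) : {ffun {ffun 'I_(size s) -> F} -> F * F} :=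
  [ffun v : {ffun 'I_(size s) -> F} =>
    (g (teval (fun i => h (v i)) (TMul t (TInv t))),
     g (teval (fun i => h (v i)) (TMul (TInv t) t)))].
have identity (u v : iterm 'I_(size s)) :
    subclass groups (satisfies u v) -> satisfies u v S -> teval r u = teval r v.
  move=> Guv Suv; apply: (VT _ (variety_satisfies u v)) => U [/Guv//|].
  by apply; [exact: variety_satisfies | move=> _ ->].
have profE t u : prof t = prof u -> greenH (teval r t) (teval r u).
  move=> tu; have [tu1 tu2] :
      satisfies (TMul t (TInv t)) (TMul u (TInv u)) S /\
      satisfies (TMul (TInv t) t) (TMul (TInv u) u) S.
    split=> q; have := congr1 (fun k : {ffun _ -> _} => k [ffun i => g (q i)]) tu;
      rewrite !ffunE; (have -> : (fun i => h ([ffun i => g (q i)] i)) = q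
        by apply/funext => i; rewrite ffunE) => -[e1 e2].
      by rewrite -[LHS]hg e1 hg.
    by rewrite -[LHS]hg e2 hg.
  apply: greenH_idem.
    apply: (identity _ _ _ tu1) => U [e He] q /=.
    by have [_ _ -> _] := He (teval q t); have [_ _ -> _] := He (teval q u).
  apply: (identity _ _ _ tu2) => U [e He] q /=.
  by have [_ _ _ ->] := He (teval q t); have [_ _ _ ->] := He (teval q u).
apply: (@green_classes_finite _ _ _ _ (teval r) prof).
  apply/seteqP; split=> // x _.
  have Ux : smallest (@subalgebra T) X x by rewrite gX.
  apply: smallest_teval Ux => y.
  by rewrite Xs => /(tnthP (in_tuple s))[i ->]; exists i.
by move=> t u /profE[h1 h2]; rewrite /= /greenH /greenL /greenR h1 h2.
Qed.

(** * Finiteness of M_n *)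

Section Monogenic.
Variables (S : invSemigroup) (a : S).

(** This is a^(q+1): the shift avoids a unit, which S may not have. *)
Definition gpow q : S := iter q (fun x => mul x a) a.

Definition mulrV n (x : S) : S := iter n (fun y => mul y (inv a)) x.

Definition nform p q r : S := iter p (mul (inv a)) (mulrV r (gpow q)).

Lemma mulrV_mul n x y : mulrV n (mul x y) = mul x (mulrV n y).
Proof. by elim: n => //= n ->; rewrite mulA. Qed.

Lemma gpowD m n : mul (gpow m) (gpow n) = gpow (m + n).+1.
Proof. by elim: n => [|n IH]; rewrite ?addn0 //= mulA IH addnS. Qed.

Lemma gpowSl n : gpow n.+1 = mul a (gpow n).
Proof. by rewrite -[n in LHS]add0n -gpowD. Qed.

Lemma nform_mul p q r x :
  mul (nform p q r) x = iter p (mul (inv a)) (mul (mulrV r (gpow q)) x).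
Proof. by rewrite /nform; elim: p => //= p <-; rewrite -mulA. Qed.

(** The idempotent a^(n+1) a^-(n+1). *)
Definition gidem n : S := mulrV n.+1 (gpow n).

Lemma gidemS n : gidem n.+1 = mul (mul a (gidem n)) (inv a).
Proof. by rewrite /gidem gpowSl mulrV_mul /= !mulA. Qed.

Lemma gidem_idem n : mul (gidem n) (gidem n) = gidem n.
Proof.
elim: n => [|n IH]; first exact: mulxV_idem.
rewrite gidemS; move: (gidem n) IH => e ee.
transitivity (mul (mul (mul a (mul e (mul (inv a) a))) e) (inv a)).
  by rewrite !mulA.
by rewrite (idem_comm ee (mulVx_idem a)) !mulA mulVK -(mulA a e) ee.
Qed.

(** Moving a^-1 from the right to the left of an idempotent a^(n+1) a^-(n+1) makes
    it grow by one. This is what brings a^-p a^(n+1) a^-(n+1) a^-1 back to a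
    normal form. *)
Lemma gidemV n : mul (gidem n) (inv a) = mul (inv a) (gidem n.+1).
Proof.
rewrite gidemS; move: (gidem n) (gidem_idem n) => e ee.
rewrite !mulA -(idem_comm ee (mulVx_idem a)).
by rewrite -mulA mulKV.
Qed.

Lemma gpowVK n : mul (mul (gpow n) (inv a)) a = gpow n.
Proof. by case: n => [|n] /=; rewrite ?mulVK // -!mulA (mulA a) mulVK. Qed.

(** Cancelling the last letter of a^(q+1) a^-(r+1): as r <= q, what precedes
    the idempotent a^r a^-r is a nonempty power of a, which absorbs the a^-1 a
    that commutes with this idempotent. *)
Lemma mulrVK q r : r <= q -> mul (mulrV r.+1 (gpow q)) a = mulrV r (gpow q).
Proof.
case: r => [_|r rq]; first exact: gpowVK.
have -> : q = ((q - r.+1) + r).+1 by lia.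
have -> : mulrV r.+2 (gpow ((q - r.+1) + r).+1) =
    mul (mulrV r.+1 (mul (gpow (q - r.+1)) (gpow r))) (inv a) by rewrite gpowD.
rewrite -gpowD mulrV_mul -/(gidem r).
move: (gidem r) (gidem_idem r) => e ee.
by rewrite -2!mulA (idem_comm ee (mulVx_idem a)) !(mulA (gpow _)) gpowVK.
Qed.

Definition nforms : set S :=
  [set x | exists p q r, [/\ p <= q.+1, r <= q.+1 & x = nform p q r]].

Lemma nforms_mulr x : nforms x -> nforms (mul x a).
Proof.
move=> [p [q [[|r] [pq rq ->]]]]; rewrite nform_mul.
  by exists p, q.+1, 0; split=> //; lia.
by exists p, q, r; rewrite mulrVK //; split=> //; lia.
Qed.

Lemma nforms_mulrV x : nforms x -> nforms (mul x (inv a)).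
Proof.
move=> [p [q [r [pq rq ->]]]]; rewrite nform_mul.
have [r_le|r_gt] := ltnP r q.+1; first by exists p, q, r.+1.
have -> : r = q.+1 by lia.
exists p.+1, q.+1, q.+2; split=> //.
by rewrite -/(gidem q) gidemV -iterSr.
Qed.

(** Every term in a takes its value in normal form: the elements whose right
    multiplications, and those of whose inverses, preserve normal forms are
    closed under the operations. *)
Lemma nforms_eval t : nforms (eval a t).
Proof.
pose U x := [/\ nforms x, nforms (inv x),
  forall y, nforms y -> nforms (mul y x) &
  forall y, nforms y -> nforms (mul y (inv x))].
suff: U (eval a t) by case.
elim: t => [|t [t1 t2 t3 t4] u [u1 u2 u3 u4]|t [t1 t2 t3 t4]] /=; last first.
- by split; rewrite ?invK.
- split; rewrite ?invM; [exact: u3|exact: t4| |] => y /=.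
    by move=> /t3/u3; rewrite mulA.
  by move=> /u4/t4; rewrite mulA.
split; [| |exact: nforms_mulr|exact: nforms_mulrV].
- by exists 0, 0, 0.
- by exists 1, 0, 1; split=> //; rewrite /nform /= mulA mulKV.
Qed.

(** The middle power a^(q+1) is a multiple of a^(m+1), and the outer factors stay
    in the ideal. *)
Lemma nform_ideal J p q r m :
  ideal J -> J (gpow m) -> m <= q -> J (nform p q r).
Proof.
move=> iJ Jm mq.
have Jq : J (gpow q).
  rewrite -(subnKC mq); elim: (q - m) => [|k]; first by rewrite addn0.
  by rewrite addnS => /(iJ a)[].
have Jr : J (mulrV r (gpow q)).
  by elim: r => //= r /(iJ (inv a))[].
by rewrite /nform; elim: p => //= p /(iJ (inv a))[].
Qed.

End Monogenic.

Lemma FIS_eval t : eval FIS_gen t = cls term_eq t.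
Proof.
elim: t => //= [t -> u ->|t ->]; first exact: FIS_mulE.
exact: FIS_invE.
Qed.

Lemma iterop_gpow (S : invSemigroup) (a : S) m :
  iterop m.+1 (@mul S) a a = gpow a m.
Proof. by elim: m => // m IH; rewrite gpowSl -IH. Qed.

(** Exponents up to n are enough: the class of any a^-p a^(q+1) a^-r with q+1 >= n
    is the zero of M_n, which is also the class of a^(n+1). *)
Definition M_enum n (c : 'I_n.+1 * 'I_n.+1 * 'I_n.+1) : M n :=
  cls _ (nform FIS_gen c.1.1 c.1.2 c.2).

Lemma M_enum_surj n (X : M n) : 0 < n -> exists c, M_enum c = X.
Proof.
case: n X => // m X _; rewrite -(repK X); move: (rep X) => x.
have iJ := @smallest_ideal FIS [set iterop m.+1 (@mul FIS) FIS_gen FIS_gen].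
have Jm : smallest (@ideal FIS) [set iterop m.+1 (@mul FIS) FIS_gen FIS_gen]
    (gpow FIS_gen m).
  by apply: sub_gen_smallest; symmetry; exact: iterop_gpow.
have [p [q [r [pq rq xE]]]] : nforms FIS_gen x.
  by rewrite -(repK x) -FIS_eval; apply: nforms_eval.
have [mq|qm] := leqP m q.
  exists (ord0, ord_max, ord0); apply/(clsP (rees_eq_equiv _)); right.
  rewrite xE; split; apply: (nform_ideal _ _ iJ Jm) => //=.
exists (inord p, inord q, inord r); rewrite /M_enum /= !inordK ?xE //; lia.
Qed.

(** * Subalgebras and powers *)

Section Restrict.
Variables (S : invSemigroup) (U : set S).
Hypotheses (U_sub : subalgebra U) (U_nonempty : exists x, U x).

Definition restrict_mul (x y : {x | U x}) : {x | U x} :=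
  exist _ (mul (sval x) (sval y)) (U_sub.1 _ _ (svalP x) (svalP y)).

Definition restrict_inv (x : {x | U x}) : {x | U x} :=
  exist _ (inv (sval x)) (U_sub.2 _ (svalP x)).

Lemma restrict_inj (x y : {x | U x}) : sval x = sval y -> x = y.
Proof. by case: x y => [x Ux] [y Uy] /= e; apply: eq_exist. Qed.

Lemma restrict_mulA x y z :
  restrict_mul x (restrict_mul y z) = restrict_mul (restrict_mul x y) z.
Proof. by apply: restrict_inj; rewrite /= mulA. Qed.

Lemma restrict_invP x y :
  restrict_mul (restrict_mul x y) x = x /\
  restrict_mul (restrict_mul y x) y = y <-> y = restrict_inv x.
Proof.
split=> [[h1 h2]|->].
  apply: restrict_inj; apply: inv_unique.
    exact: (congr1 sval h1).
  exact: (congr1 sval h2).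
by split; apply: restrict_inj; rewrite /= ?mulVK ?mulKV.
Qed.

Definition restrict : invSemigroup :=
  InvSemigroup (let: ex_intro x Ux := U_nonempty in ex_intro _ (exist _ x Ux) I)
    restrict_mulA restrict_invP.

Lemma variety_restrict (V : isclass) : variety V -> V S -> V restrict.
Proof.
by move=> [_ VS _] /(VS S restrict sval); apply => //; exact: restrict_inj.
Qed.

End Restrict.

Section Power.
Variables (I : Type) (S : invSemigroup).

Definition power_mul (x y : I -> S) : I -> S := fun i => mul (x i) (y i).

Definition power_inv (x : I -> S) : I -> S := fun i => inv (x i).

Lemma power_mulA x y z :
  power_mul x (power_mul y z) = power_mul (power_mul x y) z.
Proof. by apply/funext => i; rewrite /power_mul mulA. Qed.

Lemma power_invP x y :
  power_mul (power_mul x y) x = x /\ power_mul (power_mul y x) y = y <->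
  y = power_inv x.
Proof.
split=> [[h1 h2]|->].
  apply/funext => i; apply: inv_unique.
    exact: (congr1 (fun f => f i) h1).
  exact: (congr1 (fun f => f i) h2).
by split; apply/funext => i; rewrite /power_mul /power_inv ?mulVK ?mulKV.
Qed.

Definition power : invSemigroup :=
  InvSemigroup (let: ex_intro x _ := carrier_nonempty S in ex_intro _ (fun=> x) Logic.I)
    power_mulA power_invP.

Lemma variety_power (V : isclass) : variety V -> V S -> V power.
Proof.
move=> [_ _ VP] VS; apply: (VP I (fun=> S) power (fun i x => x i)) => //.
split=> // x; exists x; split=> // y h; apply/funext => i; exact/esym.
Qed.

End Power.

(** * Infinitely many J-classes *)

Section JClasses.
Variable S : invSemigroup.

Lemma jideal_id (a : S) : jideal a a.
Proof. by constructor. Qed.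

Lemma jideal_sub (a b : S) : jideal b a -> jideal a `<=` jideal b.
Proof.
move=> ba x [->//|[s ->]|[t ->]|[s [t ->]]];
  case: ba => [->|[s' ->]|[t' ->]|[s' [t' ->]]].
- by constructor 2; exists s.
- by constructor 2; exists (mul s s'); rewrite mulA.
- by constructor 4; exists s, t'; rewrite !mulA.
- by constructor 4; exists (mul s s'), t'; rewrite !mulA.
- by constructor 3; exists t.
- by constructor 4; exists s', t.
- by constructor 3; exists (mul t' t); rewrite !mulA.
- by constructor 4; exists s', (mul t' t); rewrite !mulA.
- by constructor 4; exists s, t.
- by constructor 4; exists (mul s s'), t; rewrite !mulA.
- by constructor 4; exists s, (mul t' t); rewrite !mulA.
- by constructor 4; exists (mul s s'), (mul t' t); rewrite !mulA.
Qed.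

Lemma greenJ_jideal (a b : S) : jideal a b -> jideal b a -> greenJ a b.
Proof. by move=> ab ba; apply/seteqP; split; exact: jideal_sub. Qed.

Lemma greenL_J (a b : S) : greenL a b -> greenJ a b.
Proof.
have sub (c d : S) : lideal c = lideal d -> jideal d c.
  move=> cd; have : lideal c c by left.
  by rewrite cd => -[->|[s ->]]; [constructor | constructor 2; exists s].
by move=> ab; apply: greenJ_jideal; apply: sub; rewrite // ab.
Qed.

Lemma greenR_J (a b : S) : greenR a b -> greenJ a b.
Proof.
have sub (c d : S) : rideal c = rideal d -> jideal d c.
  move=> cd; have : rideal c c by left.
  by rewrite cd => -[->|[s ->]]; [constructor | constructor 3; exists s].
by move=> ab; apply: greenJ_jideal; apply: sub; rewrite // ab.
Qed.

Lemma green_rel_J K (a b : S) : green_rel K a b -> greenJ a b.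
Proof.
case: K => //=; [by case=> /greenL_J|exact: greenL_J|exact: greenR_J|].
elim=> [x y [/greenL_J|/greenR_J]//|//|x y _|x y z _ + _].
  exact: esym.
exact: eq_trans.
Qed.

Lemma green_rel_refl K (a : S) : green_rel K a a.
Proof. by case: K => //=; exact: rst_refl. Qed.

(** Every Green relation refines J, so J-inequivalent elements are
    inequivalent for each of them. *)
Lemma J_infinite K (u : nat -> S) :
  (forall m n, jideal (u m) (u n) -> m <= n) -> ~ green_finite K S.
Proof.
move=> hu fK; apply: infinite_nat.
pose c n := [set b | green_rel K (u n) b].
have cI : injective c.
  move=> m n cmn.
  have : c m (u n) by rewrite cmn; exact: green_rel_refl.
  move=> /green_rel_J e; apply/eqP; rewrite eqn_leq.
  by rewrite !hu //; [rewrite -e|rewrite e]; exact: jideal_id.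
have -> : [set: nat] = c @^-1` (@green_classes K S).
  by apply/seteqP; split=> // n _; exists (u n).
by apply: finite_preimage fK => m n _ _; exact: cI.
Qed.

End JClasses.

(** The subalgebra generated by X inherits the separation of the u n: an ideal of
    a subalgebra is contained in the corresponding ideal of S. *)
Lemma not_locally_finite (V : isclass) (S : invSemigroup) (X : set S)
    (u : nat -> S) K :
  variety V -> V S -> finite_set X ->
  (forall n, smallest (@subalgebra S) X (u n)) ->
  (forall m n, jideal (u m) (u n) -> m <= n) ->
  ~ locally_finite K V.
Proof.
move=> vV VS fX Xu hu lf.
set U := smallest (@subalgebra S) X in Xu.
have U_sub : subalgebra U := smallest_subalgebra X.
have U0 : exists x, U x by exists (u 0).
pose T := restrict U_sub U0.
apply: (@J_infinite T K (fun n => exist _ (u n) (Xu n))).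
  move=> m n h; apply: hu.
  case: h => [e|[s e]|[t e]|[s [t e]]]; have {e} := congr1 sval e; simpl => e.
  - by constructor.
  - by constructor 2; exists (sval s).
  - by constructor 3; exists (sval t).
  - by constructor 4; exists (sval s), (sval t).
apply: lf; first exact: variety_restrict.
exists [set x : T | X (sval x)]; split.
  by apply: (@finite_preimage T S) fX => x y _ _; exact: restrict_inj.
apply/seteqP; split=> // -[x Ux] _ W [W_sub XW].
(* The image in S of a subalgebra W of T that contains the generators is a
   subalgebra of S that contains X, hence all of U. *)
suff: (@sval S U @` W) x.
  by case=> w Ww /= wx; rewrite -(restrict_inj (x := w) (y := exist _ x Ux) wx).
apply: Ux; split.
  split=> [_ _ [y Wy <-] [z Wz <-]|_ [y Wy <-]].
    by exists (@mul T y z); first exact: W_sub.1.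
  by exists (@inv T y); first exact: W_sub.2.
by move=> y Xy; exists (exist _ y (sub_gen_smallest Xy)); first exact: XW.
Qed.

(** * The bicyclic semigroup *)

Definition opposite_shift : set (power bool bicyclic) :=
  [set x | (x true).1 + (x false).1 = (x true).2 + (x false).2].

(** The condition i+k = j+l is what makes the size of an element monotone below:
    without it, B x B is bisimple and its ideals separate nothing. *)
Lemma opposite_shift_sub : subalgebra opposite_shift.
Proof.
split=> [x y|x]; rewrite /opposite_shift /= /power_mul /power_inv /=.
  case: (x true) (x false) (y true) (y false) => [a b] [c d] [a' b'] [c' d'].
  by rewrite /bicyclic_mul /=; lia.
by case: (x true) (x false) => [a b] [c d] /=; lia.
Qed.

Lemma bicyclic_not_locally_finite K (V : isclass) :
  variety V -> V bicyclic -> ~ locally_finite K V.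
Proof.
move=> vV VB.
pose g : power bool bicyclic := fun b => if b then (1, 0) else (0, 1).
have U0 : exists x, opposite_shift x by exists g.
pose S := restrict opposite_shift_sub U0.
have VS : V S by apply: variety_restrict => //; exact: variety_power.
pose a : S := exist _ g erefl.
(* The sum of the first entries grows under right multiplication, and the sum of
   the second entries under left multiplication; the two sums agree here. *)
pose size (x : S) := (sval x true).1 + (sval x false).1.
have sizeM (x y : S) : size x <= size (mul x y) /\ size y <= size (mul x y).
  case: x y => [x Ux] [y Uy]; move: Ux Uy; rewrite /size /opposite_shift /=.
  rewrite /power_mul /= /bicyclic_mul /=.
  case: (x true) (x false) (y true) (y false) => [p q] [r s] [p' q'] [r' s'] /=.
  by lia.
have size_gpow n : size (gpow a n) = n.+1.
  suff [h1 h2] : sval (gpow a n) true = (n.+1, 0) /\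
                 sval (gpow a n) false = (0, n.+1) by rewrite /size h1 h2 /= addn0.
  have gpowS k b : sval (gpow a k.+1) b = bicyclic_mul (sval (gpow a k) b) (g b).
    by [].
  elim: n => // n; rewrite !gpowS => -[-> ->].
  by rewrite /bicyclic_mul /=; split; congr pair; lia.
apply: (@not_locally_finite V S [set a] (gpow a)) => //.
- have [UM _] := smallest_subalgebra [set a].
  have Ua : smallest (@subalgebra S) [set a] a by apply: sub_gen_smallest.
  by elim=> //= n IH; apply: UM.
- move=> m n; rewrite -ltnS -!size_gpow.
  case=> [->//|[s ->]|[t ->]|[s [t ->]]].
  + exact: (sizeM _ _).2.
  + exact: (sizeM _ _).1.
  + exact: leq_trans (sizeM _ _).2 (sizeM _ _).1.
Qed.

(** * Partial maps of labelled paths *)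

Section WordGraph.
Variables (A : finType) (w : nat -> A).

(** The edge from k to k+1 of a path has label [w k]. The segments from i to j and
    from i' to j' are read in the same direction, forwards or backwards, with
    the same labels. *)
Definition same_label i j i' j' : Prop :=
  i + j' = i' + j /\
  forall k k', i + k' = i' + k -> (i <= k < j) || (j <= k < i) -> w k = w k'.

Lemma same_label_sym i j i' j' : same_label i j i' j' -> same_label j i j' i'.
Proof.
move=> [e h]; split; first by lia.
by move=> k k' kk' hk; apply: h; [lia | rewrite orbC].
Qed.

Lemma same_label_trans i j l i' j' l' :
  same_label i j i' j' -> same_label j l j' l' -> same_label i l i' l'.
Proof.
move=> [e h] [e' h']; split; first by lia.
move=> k k' kk' hk.
(* Backtracking is harmless: an edge between i and l is crossed on the way from i
   to j or on the way from j to l. *)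
have [hij|hjl] : (i <= k < j) || (j <= k < i) \/ (j <= k < l) || (l <= k < j)
  by lia.
  by apply: h.
by apply: h' => //; lia.
Qed.

(** For i <= N, the pair (N, i) is the vertex i of the path of length N; the other
    pairs are isolated vertices. *)
Definition vertex : Type := nat * nat.

(** Two pairs of a relation share one displacement, so such a relation is
    automatically the graph of a partial injection; see [path_map_fun] and
    [path_map_inj]. *)
Definition label_preserving (R : vertex -> vertex -> Prop) : Prop :=
  forall x y x' y', R x y -> R x' y' -> x.1 = y.1 /\ same_label x.2 y.2 x'.2 y'.2.

Definition path_map := {R | label_preserving R}.

Lemma path_map_ext (f g : path_map) :
  (forall x y, sval f x y <-> sval g x y) -> f = g.
Proof.
case: f g => [f hf] [g hg] /= fg; apply: eq_exist.
by apply/funext => x; apply/funext => y; apply/propext.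
Qed.

Lemma path_map_fun (f : path_map) x y z : sval f x y -> sval f x z -> y = z.
Proof.
move=> xy xz; have [e1 [e2 _]] := svalP f _ _ _ _ xy xz.
have [e3 _] := svalP f _ _ _ _ xz xz.
by case: y z e1 e2 e3 {xy xz} => [y y'] [z z'] /=; move=> *; congr pair; lia.
Qed.

Lemma path_map_inj (f : path_map) x y z : sval f x z -> sval f y z -> x = y.
Proof.
move=> xz yz; have [e1 [e2 _]] := svalP f _ _ _ _ xz yz.
have [e3 _] := svalP f _ _ _ _ yz yz.
by case: x y e1 e2 e3 {xz yz} => [x x'] [y y'] /=; move=> *; congr pair; lia.
Qed.

Lemma path_map_mul_subproof (f g : path_map) :
  label_preserving (fun x z => exists y, sval f x y /\ sval g y z).
Proof.
move=> x z x' z' [y [fxy gyz]] [y' [fxy' gyz']].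
have [e1 h1] := svalP f _ _ _ _ fxy fxy'.
have [e2 h2] := svalP g _ _ _ _ gyz gyz'.
by split; [rewrite e1 | exact: same_label_trans h1 h2].
Qed.

Lemma path_map_inv_subproof (f : path_map) : label_preserving (fun x y => sval f y x).
Proof.
move=> x y x' y' fyx fyx'; have [e h] := svalP f _ _ _ _ fyx fyx'.
by split; [rewrite e | exact: same_label_sym].
Qed.

Definition path_map_mul (f g : path_map) : path_map :=
  exist label_preserving _ (@path_map_mul_subproof f g).

Definition path_map_inv (f : path_map) : path_map :=
  exist label_preserving _ (@path_map_inv_subproof f).

Lemma path_map_mulA f g h :
  path_map_mul f (path_map_mul g h) = path_map_mul (path_map_mul f g) h.
Proof.
apply: path_map_ext => x y; split=> /=.
  by move=> [z [xz [t [zt ty]]]]; exists t; split=> //; exists z.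
by move=> [t [[z [xz zt]] ty]]; exists z; split=> //; exists t.
Qed.

Lemma path_map_invP f g :
  path_map_mul (path_map_mul f g) f = f /\ path_map_mul (path_map_mul g f) g = g <->
  g = path_map_inv f.
Proof.
have sub f1 g1 x y : path_map_mul (path_map_mul f1 g1) f1 = f1 ->
    sval f1 x y -> sval g1 y x.
  move=> e fxy; have : sval (path_map_mul (path_map_mul f1 g1) f1) x y by rewrite e.
  move=> /= [t [[z [xz zt] ty]]].
  by rewrite (path_map_fun fxy xz) -(path_map_inj ty fxy).
have VK f1 : path_map_mul (path_map_mul f1 (path_map_inv f1)) f1 = f1.
  apply: path_map_ext => x y; split=> /=.
    by move=> [t [[z [xz tz] ty]]]; rewrite (path_map_inj xz tz).
  by move=> xy; exists x; split=> //; exists y.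
have VV : path_map_inv (path_map_inv f) = f by exact: path_map_ext.
split=> [[h1 h2]|->]; last first.
  by split; [exact: VK | rewrite -{2}VV; exact: VK].
by apply: path_map_ext => x y /=; split; exact: sub.
Qed.

Definition path_maps : invSemigroup :=
  InvSemigroup
    (ex_intro _ (exist label_preserving (fun _ _ => False)
                   (fun _ _ _ _ F _ => False_ind _ F)) Logic.I)
    path_map_mulA path_map_invP.

Definition squarefree : Prop :=
  forall i d, 0 < d -> exists k, i <= k < i + d /\ w k <> w (k + d).

(** If f moves x to y and y to z, the label from x to y is repeated from y to z: a
    square in w, unless x = y. Hence f f is a partial identity contained in f. *)
Lemma path_maps_C2 : squarefree -> C2 path_maps.
Proof.
move=> sqf f.
have fid x y z : sval f x y -> sval f y z -> x = y.
  move=> xy yz; have [e1 [e2 h]] := svalP f _ _ _ _ xy yz.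
  have e : x.2 = y.2.
    have [lt_xy|lt_yx|//] := ltngtP x.2 y.2.
      have [|k [hk]] := sqf x.2 (y.2 - x.2); first by lia.
      by case; apply: h; lia.
    have [|k [hk]] := sqf z.2 (x.2 - y.2); first by lia.
    by case; symmetry; apply: h; lia.
  by case: x y e1 e {xy yz e2 h} => [x x'] [y y'] /= -> ->.
apply: path_map_ext => x t; split=> /=.
  move=> [y [xy yt]]; have xy' := fid _ _ _ xy yt; subst y.
  by exists x; split=> //; exists x.
move=> [z [[y [xy yz]] zt]]; have yz' := fid _ _ _ yz zt; subst z.
by exists y.
Qed.

Definition edges_fun (c : A) (x y : vertex) : Prop :=
  [/\ y = (x.1, x.2.+1), x.2 < x.1 & w x.2 = c].

Lemma edges_subproof c : label_preserving (edges_fun c).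
Proof.
move=> x y x' y' [-> _ wx] [-> _ wx'] /=; split=> //; split; first by lia.
move=> k k' kk' hk; have [-> ->] : k = x.2 /\ k' = x'.2 by lia.
by rewrite wx.
Qed.

Definition edges c : path_maps := exist label_preserving _ (@edges_subproof c).

Fixpoint prefix_path n : path_maps :=
  if n is m.+1 then mul (prefix_path m) (edges (w n)) else edges (w 0).

Lemma prefix_path_shift n x y :
  sval (prefix_path n) x y -> [/\ y.1 = x.1, y.2 = x.2 + n.+1 & y.2 <= y.1].
Proof.
elim: n y => [|n IH] y /=; first by move=> [-> lt_x _] /=; split=> //; lia.
by move=> [z [/IH[e1 e2 le_z] [-> lt_z _]]] /=; split=> //; lia.
Qed.

Lemma prefix_path_read N n : n < N -> sval (prefix_path n) (N, 0) (N, n.+1).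
Proof.
elim: n => [|n IH] nN //=.
by exists (N, n.+1); split=> //; apply: IH; lia.
Qed.

Lemma path_map_shift0 (f : path_map) x y : sval f x y -> x.1 = y.1.
Proof. by move=> xy; have [] := svalP f _ _ _ _ xy xy. Qed.

(** The prefix of length n+1 is read in full on the path of length n+1. Every
    element maps each path into itself, so a factor of this prefix is read
    somewhere on that same path, and has length at most n+1. *)
Lemma prefix_path_jideal m n :
  jideal (prefix_path m) (prefix_path n) -> m <= n.
Proof.
have h := prefix_path_read (ltnSn n).
suff key x y : x.1 = n.+1 -> sval (prefix_path m) x y -> m <= n.
  case=> [e|[s e]|[t e]|[s [t e]]]; rewrite e in h; simpl in h.
  - exact: key h.
  - by have [x [sx xy]] := h; apply: key xy; rewrite -(path_map_shift0 sx).
  - by have [x [xy _]] := h; apply: key xy.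
  - by have [z [[x [sx xy]] _]] := h; apply: key xy; rewrite -(path_map_shift0 sx).
by move=> xn xy; have [e1 e2 le_y] := prefix_path_shift xy; lia.
Qed.

End WordGraph.

Lemma squarefree_not_locally_finite (A : finType) (w : nat -> A) K V :
  squarefree w -> variety V -> subclass C2 V -> ~ locally_finite K V.
Proof.
move=> sqf vV C2V.
apply: (@not_locally_finite V (path_maps w) (range (edges w)) (prefix_path w)) => //.
- by apply: C2V; exact: path_maps_C2.
- exact/finite_image/finite_finset.
- have [UM _] := smallest_subalgebra (range (edges w)).
  have Ue c : smallest (@subalgebra (path_maps w)) (range (edges w)) (edges w c).
    by apply: sub_gen_smallest; exists c.
  by elim=> [|n IH] /=; [exact: Ue | apply: UM].
- exact: prefix_path_jideal.
Qed.

(** * A square-free word *)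

(** For i > 0, [i %/ 2 ^ logn 2 i] is the odd part of i; its residue mod 4 is
    encoded by the parity of its half. *)
Definition fold_word i : bool * bool := (odd i, odd (i %/ 2 ^ logn 2 i %/ 2)).

Lemma fold_wordE e s : odd s -> (fold_word (2 ^ e * s)).2 = odd (s %/ 2).
Proof.
move=> os; have s_gt0 : 0 < s by case: s os.
rewrite /fold_word /= lognM ?expn_gt0 // pfactorK // lognE.
by rewrite dvdn2 os andbF addn0 mulKn // expn_gt0.
Qed.

(** The parity component excludes squares of odd period. For an even period
    d = 2^(e+1) r with r odd, every window of length d contains a number k = 2^e s
    with s odd, and k + d = 2^e (s + 2r) has odd part congruent to s + 2 mod 4, so
    the paper-folding sequence distinguishes k from k + d. *)
Lemma fold_word_squarefree : squarefree fold_word.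
Proof.
move=> i d d_gt0.
have [d_odd|d_even] := boolP (odd d).
  by exists i; split; [lia | case; rewrite oddD d_odd; case: (odd i)].
have [r co_r dE] := pfactor_coprime (isT : prime 2) d_gt0.
have r_odd : odd r by rewrite -coprime2n.
case: (logn 2 d) dE => [|e] dE; first by rewrite dE expn0 muln1 r_odd in d_even.
have e_gt0 : 0 < 2 ^ e by rewrite expn_gt0.
(* c is i / 2^e rounded up, and s the least odd number that is at least c. *)
pose c := (i + 2 ^ e - 1) %/ 2 ^ e.
pose s := c + ~~ odd c.
have s_odd : odd s by rewrite oddD oddb; case: (odd c).
have r_gt0 : 0 < r by case: r r_odd {co_r dE}.
have cE := divn_eq (i + 2 ^ e - 1) (2 ^ e).
have c_lt := ltn_pmod (i + 2 ^ e - 1) e_gt0.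
rewrite -/c in cE; rewrite expnS in dE.
exists (2 ^ e * s); split.
  by rewrite /s; case: (odd c) => /=; nia.
clearbody s; have -> : 2 ^ e * s + d = 2 ^ e * (s + r.*2) by rewrite dE; nia.
move=> /(congr1 snd); rewrite !fold_wordE ?oddD ?s_odd ?odd_double //.
rewrite -muln2 addnC divnMDl // oddD r_odd.
by case: (odd _).
Qed.

(** * Local finiteness of the varieties *)

Lemma not_locally_finite_above K (V : isclass) :
  variety V -> subclass C2 V \/ subclass (generated_by bicyclic) V ->
  ~ locally_finite K V.
Proof.
move=> vV [C2V|BV].
  exact: squarefree_not_locally_finite fold_word_squarefree vV C2V.
by apply: bicyclic_not_locally_finite => //; apply: BV => W _; apply.
Qed.

Lemma locally_finite_sub K (V W : isclass) :
  subclass V W -> locally_finite K W -> locally_finite K V.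
Proof. by move=> VW lfW S /VW; exact: lfW. Qed.

Lemma vjoin_subr (V W : isclass) : subclass W (vjoin V W).
Proof. by move=> S WS U _; apply; right. Qed.

Theorem theorem4p14 :
  [/\ locally_finite GreenH (generated_by (adjoin1 B2)),
      (forall n : nat, 0 < n -> locally_finite GreenH (generated_by (M n))),
      (forall n : nat, 0 < n ->
         locally_finite GreenH (vjoin groups (generated_by (M n))))
    & (forall V : isclass, variety V ->
         subclass V (vjoin groups (generated_by (adjoin1 B2))) ->
         locally_finite GreenH V)] /\
  (forall K : green,
    [/\ ~ locally_finite K C2,
        ~ locally_finite K (generated_by bicyclic)
      & (forall V : isclass, variety V ->
           subclass C2 V \/ subclass (generated_by bicyclic) V ->
           ~ locally_finite K V)]).
Proof.
have lfB : locally_finite GreenH (vjoin groups (generated_by (adjoin1 B2))).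
  apply: (@locally_H_finite_join_groups (option (option (bool * bool)))
            (adjoin1 B2) (fun x => x)) => x.
  by exists x.
have lfM n : 0 < n -> locally_finite GreenH (vjoin groups (generated_by (M n))).
  move=> n_gt0; apply: (locally_H_finite_join_groups (h := @M_enum n)) => X.
  exact: M_enum_surj.
split.
  split=> [|n /lfM|//|V _ VB].
  - exact: locally_finite_sub (@vjoin_subr _ _) lfB.
  - exact: locally_finite_sub (@vjoin_subr _ _).
  - exact: locally_finite_sub VB lfB.
move=> K; split; last exact: not_locally_finite_above.
  by apply: not_locally_finite_above; [exact: C2_variety | left].
by apply: not_locally_finite_above; [exact: variety_spanP | right].
Qed.
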